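(* Let $m\ge3$ be an integer and $a,b$ complex numbers. Let $f_m(z,a,b)=\sum_{n\ge0}c(n,m,a,b)z^n$ be the unique formal power series with $f_m=1+azf_m+bz^mf_m^2$, and $d_1^{(m)}(N,a,b)=\det\big(c(i+j+1,m,a,b)\big)_{i,j=0}^{N-1}$. Then $$d_1^{(m)}(mn,a,b)=(-1)^{\binom m2n}b^{mn^2}\ (n\ge0),\qquad d_1^{(m)}(mn+1,a,b)=(-1)^{\binom m2n}(n+1)ab^{mn^2+2n}\ (n\ge0),$$ $$d_1^{(m)}(mn-1,a,b)=-(-1)^{\binom m2n}nab^{mn^2-2n}\ (n\ge1),$$ and $d_1^{(m)}(N,a,b)=0$ for all other $N\ge0$.
   Context: The determinant of a $0\times0$ matrix is $1$. *)

(* Defs.v *)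
From HB Require Import structures.
From mathcomp Require Import all_boot all_order all_algebra.
From mathcomp Require Import complex reals.

Set Implicit Arguments.
Unset Strict Implicit.
Unset Printing Implicit Defensive.

Import GRing.Theory.
Local Open Scope ring_scope.

(* A formal power series is the sequence of its coefficients. *)
Definition fps (K : Type) := nat -> K.

Definition fps_monomial (K : nzRingType) (c : K) (k : nat) : fps K :=
  fun n => if n == k then c else 0.

Definition fps_one (K : nzRingType) : fps K := fps_monomial 1 0.

Definition fps_add (K : nzRingType) (f g : fps K) : fps K :=
  fun n => f n + g n.

Definition fps_mul (K : nzRingType) (f g : fps K) : fps K :=
  fun n => \sum_(i < n.+1) f i * g (n - i)%N.

(* f = 1 + a z f + b z^m f^2 in K[[z]] *)
Definition is_f (K : nzRingType) (m : nat) (a b : K) (f : fps K) : Prop :=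
  f =1 fps_add (fps_add (fps_one K) (fps_mul (fps_monomial a 1) f))
               (fps_mul (fps_monomial b m) (fps_mul f f)).

Definition d1 (K : comNzRingType) (c : fps K) (N : nat) : K :=
  \det (\matrix_(i < N, j < N) c (i + j + 1)%N).

Lemma fps_mul_monomial (K : nzRingType) (c : K) (k : nat) (f : fps K) (n : nat) :
  fps_mul (fps_monomial c k) f n = if (k <= n)%N then c * f (n - k)%N else 0.
Proof.
rewrite /fps_mul /fps_monomial; case: leqP => kn.
  rewrite (bigD1 (Ordinal (n := n.+1) (m := k) kn)) //= eqxx big1 ?addr0 //.
  by move=> i /eqP ik; case: eqP => [e|]; [case: ik; apply: val_inj|rewrite mul0r].
apply: big1 => i _; case: eqP => [e|]; last by rewrite mul0r.
by have := ltn_ord i; rewrite e ltnS leqNgt kn.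
Qed.

Lemma is_fE (K : nzRingType) (m : nat) (a b : K) (f : fps K) :
  is_f m a b f <-> forall n, f n = (n == 0)%:R
    + (if (0 < n)%N then a * f n.-1 else 0)
    + (if (m <= n)%N then b * \sum_(i < (n - m).+1) f i * f (n - m - i)%N else 0).
Proof.
have E n : fps_add (fps_add (fps_one K) (fps_mul (fps_monomial a 1) f))
    (fps_mul (fps_monomial b m) (fps_mul f f)) n = (n == 0)%:R
    + (if (0 < n)%N then a * f n.-1 else 0)
    + (if (m <= n)%N then b * \sum_(i < (n - m).+1) f i * f (n - m - i)%N else 0).
  rewrite /fps_add !fps_mul_monomial subn1 /fps_one /fps_monomial.
  by case: (n == 0).
by split=> H n; rewrite H E.
Qed.

Lemma is_f_unique (K : nzRingType) (m : nat) (a b : K) (f g : fps K) :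
  (0 < m)%N -> is_f m a b f -> is_f m a b g -> f =1 g.
Proof.
move=> m0 /is_fE Hf /is_fE Hg n; elim/ltn_ind: n => n IH.
rewrite Hf Hg; congr (_ + _ + _).
  by case: ifP => // n0; rewrite IH // prednK.
case: ifP => // mn; congr (_ * _); apply: eq_bigr => i _.
have lt : (n - m < n)%N by rewrite ltn_subrL m0 (leq_trans m0 mn).
have le : (i <= n - m)%N by rewrite -ltnS ltn_ord.
by rewrite !IH // (leq_ltn_trans _ lt) // leq_subr.
Qed.

Fixpoint f_prefix (K : nzRingType) (m : nat) (a b : K) (n : nat) : seq K :=
  if n is n'.+1 then
    let s := f_prefix m a b n' in
    rcons s ((n' == 0)%:R + (if (0 < n')%N then a * s`_n'.-1 else 0)
      + (if (m <= n')%N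
         then b * \sum_(i < (n' - m).+1) s`_i * s`_(n' - m - i)%N else 0))
  else [::].

Lemma is_f_exists (K : nzRingType) (m : nat) (a b : K) :
  (0 < m)%N -> exists f : fps K, is_f m a b f.
Proof.
move=> m0; pose s := f_prefix m a b.
have szs n : size (s n) = n by elim: n => //= n IH; rewrite size_rcons IH.
have sE k n : (k < n)%N -> (s n)`_k = (s k.+1)`_k.
  elim: n => // n IH; rewrite ltnS leq_eqVlt => /orP[/eqP->//|kn].
  by rewrite {1}/s /= -/(s n) nth_rcons szs kn IH.
exists (fun n => (s n.+1)`_n); apply/is_fE => n.
rewrite {1}/s /= -/(s n) nth_rcons szs ltnn eqxx; congr (_ + _ + _).
  by case: n => //= n; rewrite sE.
case: ifP => // mn; congr (_ * _); apply: eq_bigr => i _.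
have lt : (n - m < n)%N by rewrite ltn_subrL m0 (leq_trans m0 mn).
have le : (i <= n - m)%N by rewrite -ltnS ltn_ord.
by rewrite !(sE _ n) // (leq_ltn_trans _ lt) // leq_subr.
Qed.

(* Main.v *)
Require Import Defs.
From HB Require Import structures.
From mathcomp Require Import all_boot all_order all_algebra.
From mathcomp Require Import complex reals.
From mathcomp Require Import zify ring.

Set Implicit Arguments.
Unset Strict Implicit.
Unset Printing Implicit Defensive.

Import GRing.Theory.
Local Open Scope ring_scope.

(* Let [u = 1/f = 1 - a z - b z^m f] and let [T(g)] be the lower triangular
   Toeplitz matrix of [g], [H(g)] the matrix [(g_(i+j+1))].  From
   [T(g) H(h) = H(g h) - H(g) T(h)^T] one gets [T(u) H(f) T(u)^T = - H(u)], that
   is [a E_00 + b H(z^m f)], and congruence of [H(z^m f)] by [T(u)] yields the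
   block diagonal matrix [diag (P, b H(f))] with [P] antitriangular of size [m].
   Since [T(u)] maps the coefficient vector of [f] to [E_0] and [E_0] to that of
   [u], the rank one perturbation [Phi(s, N) = det (H(f) + s f f^T)] satisfies
   [Phi(s, m + N) = (-1)^C(m,2) b^(m + 2 N) Phi(s + a, N)]; for [N < m] it is
   computed from the first congruence, and [s = 0] is the theorem. *)

(** * Toeplitz and Hankel matrices of power series *)

Section HankelToeplitz.
Variable K : comNzRingType.
Implicit Types f g h : fps K.

Lemma fps_mulC f g : fps_mul f g =1 fps_mul g f.
Proof.
move=> n; rewrite /fps_mul (reindex_inj rev_ord_inj) /=; apply: eq_bigr => i _.
by rewrite mulrC subSS subKn // -ltnS.
Qed.

Lemma fps_mulDl f g h :
  fps_mul (fps_add f g) h =1 fps_add (fps_mul f h) (fps_mul g h).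
Proof.
move=> n; rewrite /fps_add /fps_mul -big_split.
by apply: eq_bigr => i _; rewrite mulrDl.
Qed.

Lemma eq_fps_mul f f' g g' : f =1 f' -> g =1 g' -> fps_mul f g =1 fps_mul f' g'.
Proof. by move=> ff gg n; apply: eq_bigr => i _; rewrite ff gg. Qed.

Lemma fps_mul_monomialA x k f g :
  fps_mul (fps_mul (fps_monomial x k) f) g
    =1 fps_mul (fps_monomial x k) (fps_mul f g).
Proof.
move=> n; rewrite fps_mul_monomial {1}/fps_mul.
under eq_bigr => i _ do rewrite fps_mul_monomial.
case: leqP => kn; last first.
  apply: big1 => i _; case: leqP => ki; last by rewrite mul0r.
  by have := ltn_ord i; lia.
rewrite -(subnKC kn) -addnS big_split_ord /= big1 ?add0r; last first.
  by move=> i _; rewrite leqNgt ltn_ord mul0r.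
rewrite addKn /fps_mul mulr_sumr; apply: eq_bigr => i _.
by rewrite leq_addr mulrA addKn subnDl.
Qed.

Definition toeplitz f N : 'M[K]_N :=
  \matrix_(i, j) if (j <= i)%N then f (i - j)%N else 0.

Definition hankel f N : 'M[K]_N := \matrix_(i, j) f (i + j + 1)%N.

Lemma eq_toeplitz f g N : f =1 g -> toeplitz f N = toeplitz g N.
Proof. by move=> fg; apply/matrixP => i j; rewrite !mxE fg. Qed.

Lemma eq_hankel f g N : f =1 g -> hankel f N = hankel g N.
Proof. by move=> fg; apply/matrixP => i j; rewrite !mxE fg. Qed.

Lemma tr_hankel f N : (hankel f N)^T = hankel f N.
Proof. by apply/matrixP => i j; rewrite !mxE (addnC (j : nat)). Qed.

Lemma toeplitz_one N : toeplitz (fps_one K) N = 1%:M.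
Proof.
apply/matrixP => i j; rewrite !mxE /fps_one /fps_monomial -val_eqE /=.
by case: (ltngtP j i) => [ji||->]; rewrite ?subnn // subn_eq0 leqNgt ji.
Qed.

Lemma det_toeplitz f N : \det (toeplitz f N) = f 0 ^+ N.
Proof.
rewrite det_trig; last first.
  by apply/is_trig_mxP => i j ij; rewrite mxE leqNgt ij.
under eq_bigr => i _ do rewrite mxE leqnn subnn.
by rewrite prodr_const card_ord.
Qed.

(** Row [i] of the Toeplitz matrix meets only the rows [k <= i] of [A], so truncation to size [N]
    loses nothing. Taking [A] on all of [nat] lets each column be a power series. *)
Lemma mul_toeplitz f (A : nat -> nat -> K) N p :
  toeplitz f N *m (\matrix_(i < N, j < p) A i j)
    = \matrix_(i, j) fps_mul f (A^~ j) i.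
Proof.
apply/matrixP => i j; rewrite !mxE fps_mulC /fps_mul.
rewrite (big_ord_widen N (fun k => A k j * f (i - k)%N)) // [RHS]big_mkcond.
by apply: eq_bigr => k _; rewrite !mxE ltnS; case: ifP; rewrite ?mul0r // mulrC.
Qed.

Lemma toeplitzM f g N :
  toeplitz f N *m toeplitz g N = toeplitz (fps_mul f g) N.
Proof.
rewrite (mul_toeplitz f (fun i j => if (j <= i)%N then g (i - j)%N else 0)).
apply/matrixP => i j; rewrite !mxE.
case: leqP => ji; last first.
  by apply: big1 => k _; rewrite leqNgt (leq_ltn_trans (leq_subr _ _) ji) mulr0.
rewrite /fps_mul (big_ord_widen i.+1 (fun k => f k * g (i - j - k)%N)); last by lia.
rewrite [RHS]big_mkcond; apply: eq_bigr => k _ /=.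
have := ltn_ord k; rewrite ltnS => ki.
have -> : (k < (i - j).+1)%N = (j <= i - k)%N by lia.
by case: ifP; rewrite ?mulr0 // subnAC.
Qed.

(* The product [f g] in degree [i + j + 1] is split according to whether [f]
   contributes degree at most [i]. *)
Lemma toeplitz_hankel f g N :
  toeplitz f N *m hankel g N
    = hankel (fps_mul f g) N - hankel f N *m (toeplitz g N)^T.
Proof.
rewrite -[hankel f N]tr_hankel -trmx_mul.
rewrite (mul_toeplitz f (fun i j => g (i + j + 1)%N)).
rewrite (mul_toeplitz g (fun i j => f (i + j + 1)%N)).
apply/matrixP => i j; rewrite !mxE; apply/esym/eqP; rewrite subr_eq; apply/eqP.
rewrite {1}/fps_mul; have -> : (i + j + 1).+1 = (i.+1 + j.+1)%N by lia.
rewrite big_split_ord /=; congr (_ + _).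
  apply: eq_bigr => k _; congr (_ * g _); have := ltn_ord k; lia.
rewrite fps_mulC; apply: eq_bigr => k _.
by congr (f _ * g _); have := ltn_ord k; lia.
Qed.

(** In the first row only the last entry survives; its cofactor sign fits
    ['C(n.+1, 2) = 'C(n, 2) + n]. *)
Lemma det_antitriangular (x : K) n (A : 'M[K]_n) :
  (forall i j : 'I_n, (i + j + 1 < n)%N -> A i j = 0) ->
  (forall i j : 'I_n, (i + j + 1 = n)%N -> A i j = x) ->
  \det A = (-1) ^+ 'C(n, 2) * x ^+ n.
Proof.
elim: n A => [|n IH] A A0 Ax; first by rewrite det_mx00 !expr0 mulr1.
rewrite (expand_det_row _ ord0) (bigD1 ord_max) //= big1 ?addr0; last first.
  move=> j; rewrite -val_eqE /= => jn; rewrite A0 ?mul0r //=.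
  by have := ltn_ord j; lia.
rewrite Ax /=; last by lia.
rewrite /cofactor /= (IH (row' ord0 (col' ord_max A))).
- by rewrite add0n binS bin1 exprD exprS; ring.
- by move=> i j ij; rewrite !mxE A0 // lift_max /= /bump /=; lia.
by move=> i j ij; rewrite !mxE Ax // lift_max /= /bump /=; lia.
Qed.

End HankelToeplitz.

(** * The inverse series and the perturbed determinant *)

Section ShiftedHankel.
Variables (K : comNzRingType) (m : nat) (a b : K) (c : fps K).
Hypothesis hm : (3 <= m)%N.
Hypothesis hc : is_f m a b c.

Definition fps_inv_f : fps K :=
  fps_add (fps_add (fps_one K) (fps_monomial (- a) 1))
          (fps_mul (fps_monomial (- b) m) c).
Local Notation u := fps_inv_f.
Local Notation zm := (fps_monomial (1 : K) m).

Lemma fps_inv_fE n :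
  u n = (n == 0)%:R - a *+ (n == 1) - (if (m <= n)%N then b * c (n - m)%N else 0).
Proof.
rewrite /u /fps_add fps_mul_monomial /fps_one /fps_monomial.
congr (_ + _ + _); first by case: (n == 0%N).
  by case: (n == 1%N); rewrite ?oppr0.
by case: ifP; rewrite ?mulNr ?oppr0.
Qed.

Lemma fps_inv_fK : fps_mul u c =1 fps_one K.
Proof.
move=> n; rewrite !fps_mulDl /fps_add !fps_mulDl fps_mul_monomialA /fps_add.
rewrite !fps_mul_monomial subn0 /= mul1r [c n]hc /fps_add !fps_mul_monomial.
by do 2 case: ifP => _; ring.
Qed.

Lemma is_f_coef0 : c 0 = 1.
Proof.
by rewrite [LHS]hc /fps_add !fps_mul_monomial /= leqNgt (ltn_trans _ hm) //= !addr0.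
Qed.

Lemma fps_inv_f_small n : (n < m)%N -> u n = (n == 0)%:R - a *+ (n == 1).
Proof. by move=> nm; rewrite fps_inv_fE leqNgt nm subr0. Qed.

Lemma det_inv_toeplitz N : \det (toeplitz u N) = 1.
Proof. by rewrite det_toeplitz fps_inv_f_small ?(ltn_trans _ hm) // subr0 expr1n. Qed.

Lemma det_congr_toeplitz N (A : 'M[K]_N) :
  \det (toeplitz u N *m A *m (toeplitz u N)^T) = \det A.
Proof. by rewrite !det_mulmx det_tr det_inv_toeplitz mulr1 mul1r. Qed.

(** This is [Phi(s, N)]; the parameter [s] closes the recursion, since reducing the size by [m] only
    moves [s] to [s + a]. *)
Definition hankel_pert s N : K :=
  \det (\matrix_(i < N, j < N) (c (i + j + 1)%N + s * (c i * c j))).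

(** * Congruences by the Toeplitz matrix of [u] *)

Lemma congr_outer N (s : K) (p q : fps K) : fps_mul u p =1 q ->
  toeplitz u N *m (\matrix_(i < N, j < N) (s * (p i * p j))) *m (toeplitz u N)^T
  = \matrix_(i, j) (s * (q i * q j)).
Proof.
move=> pq; have E (x y : fps K) : \matrix_(i < N, j < N) (s * (x i * y j))
   = s *: ((\matrix_(i < N, j < 1) x i) *m (\matrix_(i < N, j < 1) y i)^T).
  by apply/matrixP => i j; rewrite !mxE big_ord1 !mxE.
rewrite !E -scalemxAr -scalemxAl mulmxA -(mulmxA _ _ (toeplitz u N)^T) -trmx_mul.
rewrite (mul_toeplitz u (fun i _ => p i)).
by congr (_ *: (_ *m _^T)); apply/matrixP => i j; rewrite !mxE /= pq.
Qed.

(** Hankel entries start at degree 1, so the term from [u c = 1] vanishes; in the other one the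
    Toeplitz factors of [c] and [u] cancel. *)
Lemma congr_hankel_f N :
  toeplitz u N *m hankel c N *m (toeplitz u N)^T = - hankel u N.
Proof.
rewrite toeplitz_hankel (eq_hankel N fps_inv_fK) mulmxBl -mulmxA -trmx_mul.
rewrite toeplitzM (eq_toeplitz N fps_inv_fK) toeplitz_one trmx1 mulmx1.
have -> : hankel (fps_one K) N = 0; last by rewrite mul0mx sub0r.
by apply/matrixP => i j; rewrite !mxE addn1.
Qed.

(** The term [- a z] of [u] only meets the corner, which is written as an outer product so that
    [congr_outer] applies to it. *)
Lemma hankel_inv_f N : - hankel u N
  = \matrix_(i, j) (a * (fps_one K i * fps_one K j)) + b *: hankel (fps_mul zm c) N.
Proof.
apply/matrixP => i j; rewrite !mxE fps_inv_fE fps_mul_monomial /fps_one /fps_monomial.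
rewrite addn1 /= eqSS addn_eq0 mul1r sub0r opprD !opprK; congr (_ + _).
  by do 2 case: (_ == _); rewrite /= ?mul0r ?mulr0 ?mulr1.
by case: ifP; rewrite ?mulr0.
Qed.

(** Since [u z^m c = z^m], two uses of [toeplitz_hankel] leave [H(z^m u)] minus [H(u) T(z^m)^T] and
    its transpose. The three terms cancel when exactly one index is at least [m], hence the block
    diagonal shape. *)
Lemma congr_hankel_shift N :
  toeplitz u N *m hankel (fps_mul zm c) N *m (toeplitz u N)^T
  = \matrix_(i, j)
      ((if (m <= i + j + 1)%N then u (i + j + 1 - m)%N else 0)
       - (if (m <= i)%N then u (i + j + 1 - m)%N else 0)
       - (if (m <= j)%N then u (i + j + 1 - m)%N else 0)).
Proof.
have ug : fps_mul u (fps_mul zm c) =1 zm.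
  move=> n; rewrite fps_mulC fps_mul_monomialA (eq_fps_mul (frefl _) (fps_mulC c u)).
  by rewrite (eq_fps_mul (frefl _) fps_inv_fK) fps_mulC fps_mul_monomial subn0 mul1r.
rewrite toeplitz_hankel (eq_hankel N ug) mulmxBl -mulmxA -trmx_mul toeplitzM.
rewrite (eq_toeplitz N ug) -(tr_hankel zm) -trmx_mul toeplitz_hankel.
have -> : hankel u N *m (toeplitz zm N)^T =
    \matrix_(i, j) if (m <= j)%N then u (i + j + 1 - m)%N else 0.
  rewrite -(tr_hankel u) -trmx_mul (mul_toeplitz _ (fun i j => u (i + j + 1)%N)).
  apply/matrixP => i j; rewrite !mxE fps_mul_monomial mul1r.
  by case: ifP => // h; congr u; lia.
apply/matrixP => i j; rewrite !mxE fps_mulC fps_mul_monomial mul1r.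
by rewrite (addnC (j : nat)).
Qed.

Lemma hankel_pert_shift s N :
  hankel_pert s N = \det (\matrix_(i, j) ((a + s) * (fps_one K i * fps_one K j))
                   + b *: hankel (fps_mul zm c) N).
Proof.
rewrite /hankel_pert -det_congr_toeplitz.
have -> : \matrix_(i < N, j < N) (c (i + j + 1)%N + s * (c i * c j))
   = hankel c N + \matrix_(i, j) (s * (c i * c j)).
  by apply/matrixP => i j; rewrite !mxE.
rewrite mulmxDr mulmxDl congr_hankel_f (congr_outer N s fps_inv_fK).
rewrite hankel_inv_f addrAC; congr (\det (_ + _)).
by apply/matrixP => i j; rewrite !mxE mulrDl.
Qed.

Lemma hankel_pert_blocks s N :
  hankel_pert s N = \det (\matrix_(i < N, j < N) ((a + s) * (u i * u j) +
    b * ((if (m <= i + j + 1)%N then u (i + j + 1 - m)%N else 0)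
       - (if (m <= i)%N then u (i + j + 1 - m)%N else 0)
       - (if (m <= j)%N then u (i + j + 1 - m)%N else 0)))).
Proof.
rewrite hankel_pert_shift -det_congr_toeplitz mulmxDr mulmxDl.
rewrite -scalemxAr -scalemxAl congr_hankel_shift.
have u1 : fps_mul u (fps_one K) =1 u.
  by move=> n; rewrite fps_mulC fps_mul_monomial subn0 mul1r.
rewrite (congr_outer N _ u1); congr (\det _).
by apply/matrixP => i j; rewrite !mxE.
Qed.

(** * Sizes below [m], and reduction of the size by [m] *)

Lemma hankel_pert0 s : hankel_pert s 0 = 1.
Proof. exact: det_mx00. Qed.

Lemma hankel_pert1 s : hankel_pert s 1 = a + s.
Proof.
rewrite hankel_pert_shift det_mx11 !mxE fps_mul_monomial leqNgt ltnW //=.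
by rewrite !mulr1 mulr0 addr0.
Qed.

Lemma hankel_pert_mid s N : (2 <= N)%N -> (N.+2 <= m)%N -> hankel_pert s N = 0.
Proof.
case: N => [|[|N]] // _ Nm; rewrite hankel_pert_shift.
(* Row 1 vanishes: it misses the corner, and its degrees [j + 2] stay below [m]. *)
rewrite (expand_det_row _ (lift ord0 ord0)) big1 // => j _.
rewrite !mxE /fps_one /fps_monomial /= mul0r mulr0 add0r fps_mul_monomial.
by rewrite ifF ?mulr0 ?mul0r //; have := ltn_ord j; rewrite /bump /=; lia.
Qed.

Lemma hankel_pert_pred s :
  hankel_pert s m.-1 = - ((-1) ^+ 'C(m, 2) * (a + s) * b ^+ (m - 2)).
Proof.
have [p mE] : exists p, m = p.+2 by exists (m - 2)%N; lia.
rewrite hankel_pert_shift mE /= subn2 /=.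
rewrite (expand_det_row _ ord0) big_ord_recl /= [X in _ + X]big1 ?addr0; last first.
  move=> j _; rewrite !mxE /fps_one /fps_monomial /= !mulr0 add0r fps_mul_monomial.
  by rewrite ifF ?mulr0 ?mul0r //; have := ltn_ord j; rewrite /bump /=; lia.
rewrite /cofactor (@det_antitriangular _ b).
(* The minor has size [p = m - 2]; the odd difference of the binomials gives the minus sign. *)
- have -> : 'C(p.+2, 2) = ('C(p, 2) + (2 * p).+1)%N by rewrite !binS !bin1 bin0; lia.
  rewrite (exprD _ 'C(p, 2)) exprS exprM sqrrN !expr1n.
  rewrite !mxE /= fps_mul_monomial /fps_one /fps_monomial /=.
  ring.
- move=> i j /= ij; rewrite !mxE /fps_one /fps_monomial /= mul0r mulr0 add0r.
  by rewrite fps_mul_monomial ifF ?mulr0 // /bump !leq0n /=; lia.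
move=> i j /= ij; rewrite !mxE /fps_one /fps_monomial /= mul0r mulr0 add0r.
rewrite fps_mul_monomial /bump /= ifT; last by lia.
by rewrite (_ : _ - p.+2 = 0)%N ?is_f_coef0 ?mul1r ?mulr1 //; lia.
Qed.

(* The matrix of [hankel_pert_blocks] is [t u u^T + b diag (P, b H)] with
   [t = a + s] and [P] the antitriangular leading block of size [m].  Write [u0]
   for the first [m] coefficients of [u] and [q] for the last basis vector of [K^m].
   Then [P q = u0], so [b P + t u0 u0^T = P (b + t q u0^T)]; as [m >= 3] also
   [u0^T q = 0], and the last factor is triangular with diagonal [b]. *)
Lemma hankel_pert_rec s N :
  hankel_pert s (m + N) = (-1) ^+ 'C(m, 2) * b ^+ (m + 2 * N) * hankel_pert (s + a) N.
Proof.
rewrite hankel_pert_blocks.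
set W := (X in \det X).
pose t := a + s.
pose P : 'M[K]_m := \matrix_(i, j) if (m <= i + j + 1)%N then u (i + j + 1 - m)%N else 0.
pose u0 : 'cV[K]_m := \col_i u i.
pose v : 'cV[K]_N := \col_i c i.
pose q : 'cV[K]_m := \col_i (i == m.-1 :> nat)%:R.
pose G : 'M[K]_N := \matrix_(i, j) (c (i + j + 1)%N + t * (c i * c j)).
have uq : u0^T *m q = 0.
  apply/matrixP => i j; rewrite !mxE big1 // => k _; rewrite !mxE.
  case: eqP => [->|_]; last by rewrite mulr0.
  rewrite fps_inv_f_small ?prednK ?(ltn_trans _ hm) //.
  by rewrite !gtn_eqF ?subr0 ?mul0r //; lia.
have Pq : P *m q = u0.
  have lt : (m.-1 < m)%N by rewrite prednK ?(ltn_trans _ hm).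
  apply/matrixP => i j; rewrite !mxE (bigD1 (Ordinal lt)) //= !mxE /= eqxx mulr1.
  rewrite big1 ?addr0; last first.
    by move=> k; rewrite -val_eqE /= !mxE => /negbTE->; rewrite mulr0.
  by rewrite ifT; [congr u | ]; lia.
have geF (k : 'I_m) : (m <= k)%N = false by rewrite leqNgt ltn_ord.
(* Beyond degree [m] one has [u (m + k) = - b * c k], so [G], the matrix of size [N] for the
   parameter [t], reappears with factor [b ^+ 2]. *)
have WE : W = block_mx (P *m (b%:M + t *: (q *m u0^T))) (- (t * b) *: (u0 *m v^T))
                       (- (t * b) *: (v *m u0^T)) (b ^+ 2 *: G).
  apply/matrixP => i j; rewrite -(splitK i) -(splitK j).
  case: (split i) => {}i; case: (split j) => {}j /=;
    rewrite ?(block_mxEul, block_mxEur, block_mxEdl, block_mxEdr).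
  - rewrite mulmxDr mul_mx_scalar -scalemxAr mulmxA Pq.
    rewrite !mxE big_ord1 !mxE /= !geF !subr0.
    by rewrite addrC.
  - rewrite !mxE big_ord1 !mxE /= geF leq_addr subr0.
    rewrite [u (m + j)]fps_inv_fE leq_addr addKn ifT; last by lia.
    rewrite !gtn_eqF; [|lia|lia].
    by rewrite !mulr0n /t; ring.
  - rewrite !mxE big_ord1 !mxE /= geF leq_addr subr0.
    rewrite [u (m + i)]fps_inv_fE leq_addr addKn ifT; last by lia.
    rewrite !gtn_eqF; [|lia|lia].
    by rewrite !mulr0n /t; ring.
  rewrite !mxE /= !leq_addr ifT; last by lia.
  rewrite subrr sub0r (_ : m + i + (m + j) + 1 - m = m + (i + j + 1))%N; last by lia.
  rewrite !fps_inv_fE !leq_addr !addKn !gtn_eqF; try lia.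
  by rewrite !mulr0n /t; ring.
(* A unipotent column operation clears the upper right block; by [uq] it leaves the lower right one
   unchanged. *)
have WR : W *m block_mx 1%:M (t *: (q *m v^T)) 0 1%:M
   = block_mx (P *m (b%:M + t *: (q *m u0^T))) 0
              (- (t * b) *: (v *m u0^T)) (b ^+ 2 *: G).
  rewrite WE mulmx_block !mulmx1 !mulmx0 !addr0; congr block_mx.
    have Bq : (b%:M + t *: (q *m u0^T)) *m q = b *: q.
      by rewrite mulmxDl mul_scalar_mx -scalemxAl -mulmxA uq mulmx0 scaler0 addr0.
    rewrite -scalemxAr mulmxA -(mulmxA P) Bq -scalemxAr Pq -scalemxAl scalerA.
    by rewrite scaleNr subrr.
  by rewrite -scalemxAl -scalemxAr mulmxA -(mulmxA v) uq mulmx0 mul0mx !scaler0 add0r.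
have := congr1 determinant WR.
rewrite det_mulmx det_ublock !det1 !mulr1 det_lblock detZ det_mulmx => ->.
rewrite (@det_antitriangular _ 1 m P); last first.
- by move=> i j ij; rewrite mxE ij leqnn subnn fps_inv_f_small ?subr0 // (ltn_trans _ hm).
- by move=> i j ij; rewrite mxE leqNgt ij.
rewrite det_trig; last first.
  apply/is_trig_mxP => i j ij; rewrite !mxE big_ord1 !mxE.
  rewrite -val_eqE /= ltn_eqF // mulr0n add0r ltn_eqF ?mul0r ?mulr0 //.
  have := ltn_ord j; lia.
rewrite (eq_bigr (fun=> b)); last first.
  move=> i _; rewrite !mxE eqxx big_ord1 !mxE mulr1n.
  case: eqP => [ii|_]; last by rewrite mul0r mulr0 addr0.
  rewrite fps_inv_f_small // !gtn_eqF ?subr0 ?mulr0 ?addr0 //; lia.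
rewrite prodr_const card_ord expr1n mulr1 exprD -exprM !mulrA.
by rewrite /hankel_pert /t (addrC s).
Qed.

(** The exponents [m + 2 * (m * k + r)] for [k < n] sum to [m * n ^ 2 + 2 * r * n]. *)
Lemma hankel_pert_iter s n r :
  hankel_pert s (m * n + r) =
    (-1) ^+ ('C(m, 2) * n) * b ^+ (m * n ^ 2 + 2 * r * n) * hankel_pert (s + n%:R * a) r.
Proof.
elim: n s => [|n IH] s.
  by rewrite !muln0 mul0r !addr0 !expr0 !mul1r.
rewrite mulnS -addnA hankel_pert_rec IH.
have -> : (m * n.+1 ^ 2 + 2 * r * n.+1 = (m + 2 * (m * n + r)) + (m * n ^ 2 + 2 * r * n))%N.
  by rewrite -mulnn -[in RHS]mulnn; nia.
have -> : s + n.+1%:R * a = s + a + n%:R * a by rewrite -natr1; ring.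
by rewrite mulnS !exprD; ring.
Qed.

Lemma d1_pert N : d1 c N = hankel_pert 0 N.
Proof. by congr (\det _); apply/matrixP => i j; rewrite !mxE mul0r addr0. Qed.

End ShiftedHankel.

Theorem theorem7p2 (R : realType) (m : nat) (hm : (3 <= m)%N) (a b : R[i])
    (c : fps R[i]) (hc : is_f m a b c) :
  (forall n : nat,
     d1 c (m * n) = (-1) ^+ ('C(m, 2) * n) * b ^+ (m * n ^ 2)) /\
  (forall n : nat,
     d1 c (m * n + 1) =
       (-1) ^+ ('C(m, 2) * n) * (n + 1)%:R * a * b ^+ (m * n ^ 2 + 2 * n)) /\
  (forall n : nat, (1 <= n)%N ->
     d1 c (m * n - 1) =
       - ((-1) ^+ ('C(m, 2) * n) * n%:R * a * b ^+ (m * n ^ 2 - 2 * n))) /\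
  (forall N : nat,
     (forall n : nat, N <> (m * n)%N) ->
     (forall n : nat, N <> (m * n + 1)%N) ->
     (forall n : nat, (1 <= n)%N -> N <> (m * n - 1)%N) ->
     d1 c N = 0).
Proof.
have natS n : n%:R * a + a = n.+1%:R * a by rewrite -natr1 mulrDl mul1r.
split; [|split; [|split]].
- move=> n; rewrite d1_pert -[(m * n)%N in LHS]addn0 (hankel_pert_iter hm hc) hankel_pert0.
  by rewrite muln0 mul0n addn0 mulr1.
- move=> n; rewrite d1_pert (hankel_pert_iter hm hc) (hankel_pert1 hm hc) add0r addrC natS.
  by rewrite muln1 addn1 mulrAC !mulrA mulrAC.
- case=> // n _.
  (* The residue is [m.-1] with quotient one less, so [hankel_pert_pred] applies at
     [s = n%:R * a]. *)
  have -> : (m * n.+1 - 1 = m * n + m.-1)%N by nia.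
  have -> : (m * n.+1 ^ 2 - 2 * n.+1 = (m * n ^ 2 + 2 * m.-1 * n) + (m - 2))%N.
    by rewrite -!mulnn; nia.
  rewrite d1_pert (hankel_pert_iter hm hc) (hankel_pert_pred hm hc) add0r addrC natS.
  by rewrite mulnSr !exprD; ring.
move=> N N0 N1 Np; rewrite d1_pert (divn_eq N m) mulnC (hankel_pert_iter hm hc).
have NE := divn_eq N m; have lt : (N %% m < m)%N by rewrite ltn_mod (ltn_trans _ hm).
rewrite (hankel_pert_mid hm hc) ?mulr0 //.
- have := N0 (N %/ m)%N; have := N1 (N %/ m)%N; move: NE; rewrite mulnC; lia.
(* Residue [m - 1] is excluded through the next multiple of [m]; residues 0 and 1 were excluded just
   before. *)
have := Np (N %/ m).+1 isT; rewrite mulnS; move: NE; rewrite mulnC; lia.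
Qed.
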